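(* Fix the domain $\Omega$, the Cartesian grid (hence the step size $h_C>0$ and the interior index set $\mathcal{I}$) and the matrix $\mathsf{S}^{(C)}\in\mathbb{C}^{N_C\times N_C}$, all as in the context. Assume that $\mathsf{S}^{(C)}$ is invertible and that all columns of $\mathsf{S}^{(C)}-\mathsf{I}_{N_C}$ with index $j\notin\mathcal{I}$ vanish. Then there exists $h_0>0$ such that, for every straight-edged triangulation $\mathcal{T}$ of $\Omega$ (from the mesh family considered) of mesh size $h<h_0$, equipped with a quadrature rule having positive weights, having all its nodes in the interiors of the elements, and integrating polynomials of total degree at most $1$ exactly on each element, one has $$\bigl\|(\mathsf{S}^{(C)})^{-1}(\mathsf{S}^{(C)}-\mathsf{I}_{N_C})\bigr\|_\infty\,\bigl\|\mathsf{Z}_{\mathcal{I}}\bigr\|_\infty<1,$$ where $\mathsf{Z}:=\mathsf{I}_{N_C}-\mathsf{R}^{(C)}_{\mathrm{I}}$ and $\mathsf{Z}_{\mathcal{I}}$ is the submatrix of $\mathsf{Z}$ formed by the rows indexed by $\mathcal{I}$. Consequently, the matrix $$\mathsf{Q}:=\mathsf{I}_{N_C}+(\mathsf{S}^{(C)}-\mathsf{I}_{N_C})\,\mathsf{R}^{(C)}_{\mathrm{I}}\in\mathbb{C}^{N_C\times N_C}$$ and the preconditioner $$\mathsf{P}:=\mathsf{T}_C^Q\,\mathsf{S}^{(C)}\,\mathsf{T}_Q^{C,\mathrm{I}}+\bigl(\mathsf{I}_{N_Q}-\mathsf{T}_C^Q\,\mathsf{T}_Q^{C,\mathrm{I}}\bigr)\in\mathbb{C}^{N_Q\times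 N_Q}$$ are invertible.
   Context: **Grid.** $\Omega\subset\mathbb{R}^2$ is open and bounded with piecewise smooth Lipschitz boundary (polygonal here, since the elements below are straight-edged), and $D$ is a rectangle with $\overline\Omega\subset D$. $D$ is tiled by the cells (closed axis-parallel squares of side $h_C>0$) of a uniform Cartesian grid, whose vertices are the nodes $z_1,\dots,z_{N_C}$. Each node lies either in $\Omega$ or in $D\setminus\overline\Omega$; nodes are ordered so that $\mathcal{I}=\{1,\dots,N_C^{\mathrm{int}}\}$ is the set of indices $j$ with $z_j\in\Omega$. **Mesh and quadrature.** $\mathcal{T}$ is a finite set of $N_T$ closed non-degenerate straight-edged triangles with pairwise disjoint interiors and union $\overline\Omega$; the meshes belong to a shape-regular, quasi-uniform family parametrized by the mesh size $h=\max_{\tau\in\mathcal{T}}\operatorname{diam}\tau$. $|\tau|$ is the area of $\tau$. A quadrature rule on the elements gives global nodes $y_1,\dots,y_{N_Q}\in\Omega$ and weights $\omega_1,\dots,\omega_{N_Q}$; on each $\tau$ the rule is $\int_\tau f\approx\sum_{q:\,y_q\in\tau}\omega_q f(y_q)$. **Cartesian-to-quadrature operator.** $\mathsf{T}_C^Q\in\mathbb{R}^{N_Q\times N_C}$ is bilinear interpolation: $(\mathsf{T}_C^Q)_{qj}=\psi_j(y_q)$, where $\psi_j(x)=\bigl(1-\tfrac{|x_1-z_{j,1}|}{h_C}\bigr)\bigl(1-\tfrac{|x_2-z_{j,2}|}{h_C}\bigr)$ for $x$ in a grid cell having $z_j$ as a vertex, and $\psi_j(x)=0$ otherwise. **Quadrature-to-Cartesian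 operator (Approach I, local projection).** For $\tau\in\mathcal{T}$ with vertices $v_1^{(\tau)},v_2^{(\tau)},v_3^{(\tau)}$, let $\phi_i^{(\tau)}$, $i=1,2,3$, be the affine functions with $\phi_i^{(\tau)}(v_j^{(\tau)})=\delta_{ij}$ on $\tau$, extended by zero outside $\tau$. Index $3N_T$ degrees of freedom by pairs $(\tau,i)$. Let $\mathsf{W}=\operatorname{diag}(\omega_q)\in\mathbb{R}^{N_Q\times N_Q}$; let $\mathsf{E}_Q\in\mathbb{R}^{N_Q\times 3N_T}$ have entries $(\mathsf{E}_Q)_{q,(\tau,i)}=\phi_i^{(\tau)}(y_q)$ if $y_q\in\tau$ and $0$ otherwise; let $\mathsf{M}^{\mathrm{tri}}\in\mathbb{R}^{3N_T\times 3N_T}$ be block diagonal with $3\times3$ blocks $\mathsf{M}^{(\tau)}$, $(\mathsf{M}^{(\tau)})_{ii}=|\tau|/6$ and $(\mathsf{M}^{(\tau)})_{ij}=|\tau|/12$ for $i\neq j$; let $\mathsf{E}_C\in\mathbb{R}^{N_C^{\mathrm{int}}\times 3N_T}$ have entries $(\mathsf{E}_C)_{j,(\tau,i)}=\phi_i^{(\tau)}(z_j)$ if $z_j\in\tau$ and $0$ otherwise, where, if $z_j$ lies in several elements, exactly one of them is (arbitrarily but fixedly) chosen and the entries for the other elements are set to $0$. Then $\mathsf{T}_Q^{C,\mathrm{I}}\in\mathbb{R}^{N_C\times N_Q}$ is the matrix whose rows indexed by $\mathcal{I}$ form $\mathsf{E}_C(\mathsf{M}^{\mathrm{tri}})^{-1}\mathsf{E}_Q^\top\mathsf{W}$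 and whose remaining rows are zero. The round trip is $\mathsf{R}^{(C)}_{\mathrm{I}}:=\mathsf{T}_Q^{C,\mathrm{I}}\mathsf{T}_C^Q\in\mathbb{R}^{N_C\times N_C}$. **The matrix $\mathsf{S}^{(C)}$.** $\mathsf{S}^{(C)}\in\mathbb{C}^{N_C\times N_C}$ is a fixed matrix depending only on the Cartesian grid (and on the physical data), not on $\mathcal{T}$ (the ''sparsifying preconditioner'', an approximate inverse of a Cartesian-grid discretization of the Lippmann–Schwinger equation). **Norm.** $\|\cdot\|_\infty$ is the induced $\infty$-norm (maximal absolute row sum; $0$ for a matrix with no rows). $\mathsf{I}_N$ is the $N\times N$ identity. *)

(* Defs.v *)
From HB Require Import structures.
From mathcomp Require Import all_boot all_order all_algebra.
From mathcomp Require Import all_classical all_reals all_analysis.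
From mathcomp Require Import complex ring.
Set Implicit Arguments.
Unset Strict Implicit.
Unset Printing Implicit Defensive.
Import Order.TTheory GRing.Theory Num.Theory.
Import numFieldNormedType.Exports.
Local Open Scope classical_set_scope.
Local Open Scope ring_scope.

(* MathComp + MathComp-Analysis.  The plane is R * R; its library norm is the
   sup norm, so Euclidean distances are defined explicitly. *)

Definition edist (R : realType) (x y : R * R) : R :=
  Num.sqrt ((x.1 - y.1) ^+ 2 + (x.2 - y.2) ^+ 2).

Definition diam (R : realType) (A : set (R * R)) : R :=
  sup [set edist p.1 p.2 | p in A `*` A].

(* diameter of the largest disc contained in A *)
Definition inscribed_diam (R : realType) (A : set (R * R)) : R :=
  sup [set 2 * r | r in [set r : R | 0 <= r /\
    exists c : R * R, [set x | edist c x <= r] `<=` A]].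

Definition plane_measure (R : realType) : set (R * R) -> \bar R :=
  ((@lebesgue_measure R) \x (@lebesgue_measure R))%E.

Definition area (R : realType) (A : set (R * R)) : R :=
  fine (plane_measure A).

Definition boundary (R : realType) (A : set (R * R)) : set (R * R) :=
  closure A `\` interior A.

(* Near each boundary point, and in a rotated orthonormal frame
   ((e1, e2), (-e2, e1)), Omega is the strict epigraph of a Lipschitz
   function. *)
Definition lipschitz_domain (R : realType) (Omega : set (R * R)) : Prop :=
  forall x, boundary Omega x ->
  exists (U : set (R * R)) (e : R * R) (g : R -> R),
  [/\ open U, U x, e.1 ^+ 2 + e.2 ^+ 2 = 1,
      exists k : R, k.-lipschitz g &
      forall y, U y ->
        (Omega y <-> g (e.1 * y.1 + e.2 * y.2) < - e.2 * y.1 + e.1 * y.2)].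

Definition segment (R : realType) (a b : R * R) : set (R * R) :=
  [set x | exists t : R, 0 <= t <= 1 /\
     x = ((1 - t) * a.1 + t * b.1, (1 - t) * a.2 + t * b.2)].

Definition polygonal (R : realType) (Omega : set (R * R)) : Prop :=
  exists s : seq ((R * R) * (R * R)),
    boundary Omega = \bigcup_(e in [set` s]) segment e.1 e.2.

(* Nodes are numbered by 'I_(nint + nout): the first nint ones form the
   interior index set, embedded by lshift. *)
Record grid (R : realType) := Grid {
  origin : R * R;
  step : R;
  ncell1 : nat;
  ncell2 : nat;
  nint : nat;
  nout : nat;
  node : 'I_(nint + nout) -> R * R }.

Definition grid_point (R : realType) (G : grid R) (i k : nat) : R * R :=
  ((origin G).1 + i%:R * step G, (origin G).2 + k%:R * step G).

Definition box (R : realType) (a b : R * R) : set (R * R) :=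
  [set x | a.1 <= x.1 <= b.1 /\ a.2 <= x.2 <= b.2].

Definition rectangle (R : realType) (G : grid R) : set (R * R) :=
  box (grid_point G 0 0) (grid_point G (ncell1 G) (ncell2 G)).

Definition cell (R : realType) (G : grid R) (i k : nat) : set (R * R) :=
  box (grid_point G i k) (grid_point G i.+1 k.+1).

Definition cell_vertices (R : realType) (G : grid R) (i k : nat) :
    set (R * R) :=
  [set grid_point G (i + p.1)%N (k + p.2)%N | p in [set: bool * bool]].

Record admissible_grid (R : realType) (Omega : set (R * R)) (G : grid R) :
    Prop := AdmissibleGrid {
  step_gt0 : 0 < step G;
  ncell1_gt0 : (0 < ncell1 G)%N;
  ncell2_gt0 : (0 < ncell2 G)%N;
  node_inj : injective (@node R G);
  node_range : range (@node R G) =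
    [set grid_point G p.1 p.2 | p in
       [set p : nat * nat | (p.1 <= ncell1 G)%N /\ (p.2 <= ncell2 G)%N]];
  closure_sub_rectangle : closure Omega `<=` rectangle G;
  interior_nodes : forall j : 'I_(nint G), Omega (node (lshift (nout G) j));
  exterior_nodes : forall k : 'I_(nout G),
    rectangle G (node (rshift (nint G) k)) /\
    ~ closure Omega (node (rshift (nint G) k)) }.

Definition bilinear (R : realType) (G : grid R) (j : 'I_(nint G + nout G))
    (x : R * R) : R :=
  if `[< exists i k : nat, [/\ (i < ncell1 G)%N, (k < ncell2 G)%N,
           cell G i k x & cell_vertices G i k (node j)] >]
  then (1 - `|x.1 - (node j).1| / step G) * (1 - `|x.2 - (node j).2| / step G)
  else 0.

Definition triangle (R : realType) (v : 'I_3 -> R * R) : set (R * R) :=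
  [set x | exists l : 'I_3 -> R,
     [/\ forall i, 0 <= l i, \sum_i l i = 1 &
         x = (\sum_i l i * (v i).1, \sum_i l i * (v i).2)]].

(* twice the signed area of the triangle a b c *)
Definition orient (R : realType) (a b c : R * R) : R :=
  (b.1 - a.1) * (c.2 - a.2) - (b.2 - a.2) * (c.1 - a.1).

Definition nondegenerate (R : realType) (v : 'I_3 -> R * R) : Prop :=
  orient (v 0) (v 1) (v 2) != 0.

(* Index arithmetic is modulo 3. *)
Definition barycentric (R : realType) (v : 'I_3 -> R * R) (i : 'I_3)
    (x : R * R) : R :=
  orient x (v (i + 1)) (v (i + 2)) / orient (v i) (v (i + 1)) (v (i + 2)).

Lemma barycentric_affine (R : realType) (v : 'I_3 -> R * R) (i : 'I_3) :
  exists a b c : R, forall x, barycentric v i x = a + b * x.1 + c * x.2.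
Proof.
rewrite /barycentric /orient.
set p := v (i + 1); set q := v (i + 2); set d := (_ - _)^-1.
exists ((p.1 * q.2 - p.2 * q.1) * d), ((p.2 - q.2) * d), ((q.1 - p.1) * d).
by move=> x; ring.
Qed.

Lemma barycentric_vertex (R : realType) (v : 'I_3 -> R * R) (i j : 'I_3) :
  nondegenerate v -> barycentric v i (v j) = (i == j)%:R.
Proof.
have o3 (k : 'I_3) : [\/ k = 0, k = 1 | k = 2].
  by case: k => [[|[|[|//]]] ?];
    [constructor 1|constructor 2|constructor 3]; apply/val_inj.
have e11 : 1 + 1 = 2 :> 'I_3 by apply/val_inj.
have e12 : 1 + 2 = 0 :> 'I_3 by apply/val_inj.
have e21 : 2 + 1 = 0 :> 'I_3 by apply/val_inj.
have e22 : 2 + 2 = 1 :> 'I_3 by apply/val_inj.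
rewrite /nondegenerate /barycentric => nd.
have cyc a b c : orient b c a = orient a b c :> R by rewrite /orient; ring.
have oaab a b : orient a a b = 0 :> R by rewrite /orient; ring.
have oaba a b : orient a b a = 0 :> R by rewrite /orient; ring.
have oabb a b : orient a b b = 0 :> R by rewrite /orient; ring.
by case: (o3 i) => ->; case: (o3 j) => ->;
  rewrite ?add0r ?e11 ?e12 ?e21 ?e22 ?oaab ?oaba ?oabb ?mul0r// ?mulfV//;
  rewrite -?(cyc (v 0) (v 1) (v 2)) -?(cyc (v 1) (v 2) (v 0)) in nd *.
Qed.

Definition hat (R : realType) (v : 'I_3 -> R * R) (i : 'I_3) : R * R -> R :=
  barycentric v i \_ (triangle v).

Record mesh (R : realType) := Mesh {
  nelt : nat;
  elt : 'I_nelt -> 'I_3 -> R * R }.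

Record triangulation (R : realType) (Omega : set (R * R)) (T : mesh R) :
    Prop := Triangulation {
  elt_nondegenerate : forall t : 'I_(nelt T), nondegenerate (elt t);
  elt_disjoint : forall s t : 'I_(nelt T), s != t ->
    interior (triangle (elt s)) `&` interior (triangle (elt t)) = set0;
  elt_cover : \bigcup_(t in [set: 'I_(nelt T)]) triangle (elt t) =
    closure Omega }.

Definition mesh_size (R : realType) (T : mesh R) : R :=
  \big[Num.max/0]_(t < nelt T) diam (triangle (elt t)).

Definition shape_regular (R : realType) (F : set (mesh R)) : Prop :=
  exists sigma : R, forall T, F T -> forall t : 'I_(nelt T),
    diam (triangle (elt t)) <= sigma * inscribed_diam (triangle (elt t)).

Definition quasi_uniform (R : realType) (F : set (mesh R)) : Prop :=
  exists c : R, forall T, F T -> forall t : 'I_(nelt T),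
    mesh_size T <= c * diam (triangle (elt t)).

Record quadrature (R : realType) := Quadrature {
  nquad : nat;
  qnode : 'I_nquad -> R * R;
  qweight : 'I_nquad -> R }.

Definition qsum (R : realType) (Y : quadrature R) (A : set (R * R))
    (f : R * R -> R) : R :=
  \sum_(q < nquad Y | `[< A (qnode q) >]) qweight q * f (qnode q).

Record admissible_quadrature (R : realType) (Omega : set (R * R)) (T : mesh R)
    (Y : quadrature R) : Prop := AdmissibleQuadrature {
  qnode_in : forall q : 'I_(nquad Y), Omega (qnode q);
  qweight_gt0 : forall q : 'I_(nquad Y), 0 < qweight q;
  qnode_interior : forall q : 'I_(nquad Y), exists t : 'I_(nelt T),
    interior (triangle (elt t)) (qnode q);
  exact_degree1 : forall (t : 'I_(nelt T)) (a b c : R),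
    \int[@plane_measure R]_(x in triangle (elt t)) (a + b * x.1 + c * x.2) =
    qsum Y (triangle (elt t)) (fun x => a + b * x.1 + c * x.2) }.

Definition TCQ (R : realType) (G : grid R) (Y : quadrature R) :
    'M[R]_(nquad Y, nint G + nout G) :=
  \matrix_(q, j) bilinear j (qnode q).

Definition Wmx (R : realType) (Y : quadrature R) : 'M[R]_(nquad Y) :=
  diag_mx (\row_q qweight q).

(* The 3 N_T degrees of freedom are the N_T blocks of size 3 of
   'I_(\sum_(t < N_T) 3). *)
Definition EQ (R : realType) (T : mesh R) (Y : quadrature R) :
    'M[R]_(nquad Y, \sum_(t < nelt T) 3) :=
  \mxrow_(t < nelt T) \matrix_(q < nquad Y, i < 3) hat (elt t) i (qnode q).

Definition mass (R : realType) (v : 'I_3 -> R * R) : 'M[R]_3 :=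
  \matrix_(i, j) if i == j then area (triangle v) / 6
                 else area (triangle v) / 12.

Definition Mtri (R : realType) (T : mesh R) : 'M[R]_(\sum_(t < nelt T) 3) :=
  \mxdiag_(t < nelt T) mass (elt t).

(* ch j is the element chosen for the interior node j. *)
Definition EC (R : realType) (G : grid R) (T : mesh R)
    (ch : 'I_(nint G) -> 'I_(nelt T)) :
    'M[R]_(nint G, \sum_(t < nelt T) 3) :=
  \mxrow_(t < nelt T) \matrix_(j < nint G, i < 3)
    if t == ch j then hat (elt t) i (node (lshift (nout G) j)) else 0.

Definition TQC (R : realType) (G : grid R) (T : mesh R)
    (ch : 'I_(nint G) -> 'I_(nelt T)) (Y : quadrature R) :
    'M[R]_(nint G + nout G, nquad Y) :=
  col_mx (EC ch *m invmx (Mtri T) *m (EQ T Y)^T *m Wmx Y) 0.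

Definition infnorm (R : realType) (m n : nat) (A : 'M[R[i]]_(m, n)) : R :=
  \big[Num.max/0]_(i < m) \sum_(j < n) ComplexField.Normc.normc (A i j).

Definition toC (R : realType) (m n : nat) (A : 'M[R]_(m, n)) :
    'M[R[i]]_(m, n) := map_mx (real_complex R) A.

(* Main.v *)
(** For an interior node [z] in the chosen element [tau], the row of the
    quadrature-to-Cartesian operator indexed by [z] is [K(z, y_q) w_q], with [K]
    the reproducing kernel of the affine functions on [tau].  Exactness in
    degree 1 and [int_tau phi_i = |tau| / 3] (the affine map permuting the vertices
    cyclically preserves area) give [sum_q K(z, y_q) w_q = 1] and
    [sum_q |K(z, y_q)| w_q <= 5], so the round trip reproduces at [z] a function
    with oscillation at most [e] on [tau] up to [5 e].  On the rectangle the
    bilinear hat functions are products of tents, hence vary by at most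
    [2 h / h_C] on [tau], and the entries of [Z_I] are at most [10 h / h_C].
    Since [S - 1] only sees the rows in [I], [Q = S (1 - S^-1 (S - 1) Z)] is a
    product of invertible matrices for small [h], and so is [P] by the exchange
    [1 + C D] / [1 + D C]. *)

Require Import Defs.
From HB Require Import structures.
From mathcomp Require Import all_boot all_order all_algebra.
From mathcomp Require Import all_classical all_reals all_analysis.
From mathcomp Require Import measurable_realfun.
From mathcomp Require Import complex ring lra.
Set Implicit Arguments.
Unset Strict Implicit.
Unset Printing Implicit Defensive.
Import Order.TTheory GRing.Theory Num.Theory.
Import numFieldNormedType.Exports.
Local Open Scope classical_set_scope.
Local Open Scope ring_scope.

(** * Invariance of the area under affine shears *)

Section PlaneMeasure.
Variable R : realType.
Notation mR := (measurableTypeR R).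
Notation leb := (@lebesgue_measure R).
Notation mu := (leb \x leb)%E.

(** The pushforward of Lebesgue measure under a translation agrees with it on half-open intervals,
    so uniqueness identifies the two. *)
Lemma lebesgue_measure_addr (c : R) (A : set mR) : measurable A ->
  lebesgue_measure [set x | A (x + c)] = lebesgue_measure A :> \bar R.
Proof.
move=> mA.
have mc : measurable_fun [set: mR] (fun x : mR => (x + c : mR)).
  exact: measurable_funD.
have /(_ mc _ A mA) -> // :=
  @lebesgue_measure_unique R (pushforward leb (fun x : mR => (x + c : mR))).
move=> X [[a b] _ <-]; rewrite /pushforward /=.
rewrite [X in _ = leb X](_ : _ = `]a - c, b - c]%classic); last first.
  by apply/seteqP; split => x /=; rewrite !in_itv /= ltrBlDr lerBrDr.
rewrite !lebesgue_measure_itv/= !lte_fin ltrD2r.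
by case: ifPn => // _; rewrite -!EFinB; congr EFin; ring.
Qed.

(** [mu] integrates vertical slices, whereas a horizontal shear translates horizontal ones. Both
    iterated integrals agree on rectangles, hence everywhere. *)
Lemma plane_measure_swapE (A : set (mR * mR)) : measurable A ->
  mu A = (\int[leb]_y leb (ysection A y))%E.
Proof.
move=> mA.
apply: (product_measure_unique (m' := (leb \x^ leb)%E)) => //= B C mB mC.
by rewrite product_measure2E.
Qed.

Definition hshear (a b : R) (p : mR * mR) : mR * mR := (p.1 + (a * p.2 + b), p.2).
Definition vshear (a b : R) (p : mR * mR) : mR * mR := (p.1, p.2 + (a * p.1 + b)).

Lemma measurable_hshear a b : measurable_fun setT (hshear a b).
Proof.
apply: measurable_fun_pair; last exact: measurable_snd.
apply: measurable_funD; first exact: measurable_fst.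
apply: measurable_funD; last exact: measurable_cst.
by apply: measurable_funM; [exact: measurable_cst|exact: measurable_snd].
Qed.

Lemma measurable_vshear a b : measurable_fun setT (vshear a b).
Proof.
apply: measurable_fun_pair; first exact: measurable_fst.
apply: measurable_funD; first exact: measurable_snd.
apply: measurable_funD; last exact: measurable_cst.
by apply: measurable_funM; [exact: measurable_cst|exact: measurable_fst].
Qed.

Lemma plane_measure_hshear a b (A : set (mR * mR)) : measurable A ->
  mu (hshear a b @^-1` A) = mu A.
Proof.
move=> mA.
have mB : measurable (hshear a b @^-1` A).
  by rewrite -[X in measurable X]setTI; exact: measurable_hshear.
rewrite !plane_measure_swapE//; apply: eq_integral => y _.
rewrite -(lebesgue_measure_addr (a * y + b) (measurable_ysection y mA)).
congr (leb _); apply/seteqP; split => x /=;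
  by rewrite /ysection /= !inE.
Qed.

Lemma plane_measure_vshear a b (A : set (mR * mR)) : measurable A ->
  mu (vshear a b @^-1` A) = mu A.
Proof.
move=> mA; rewrite /plane_measure /product_measure1 /=.
apply: eq_integral => x _ /=.
rewrite -(lebesgue_measure_addr (a * x + b) (measurable_xsection x mA)).
congr (leb _); apply/seteqP; split => y /=;
  by rewrite /xsection /= !inE.
Qed.

(* With [c != 0] and determinant 1, the linear part is a product of three
   shears, whose invariance is Cavalieri's principle. *)
Lemma plane_measure_affine (a b c d s t : R) (A : set (mR * mR)) :
  c != 0 -> a * d - b * c = 1 -> measurable A ->
  mu ((fun p : mR * mR => (a * p.1 + b * p.2 + s, c * p.1 + d * p.2 + t)) @^-1` A)
  = mu A.
Proof.
move=> c0 det mA.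
(* The factors are unit upper, lower and upper triangular, with off-diagonal entries [k], [c] and
   [(d - 1) / c]. The shift [s - k * t] cancels what the outer shear adds to the first coordinate
   through [t]. *)
pose k := (a - 1) / c.
have kc : k * c = a - 1 by rewrite divfK.
have -> : (fun p : mR * mR => (a * p.1 + b * p.2 + s, c * p.1 + d * p.2 + t)) =
    hshear k (s - k * t) \o (vshear c t \o hshear ((d - 1) / c) 0).
  apply/funext => -[x y]; rewrite /hshear /vshear /k /=; congr pair.
    have -> : b = (a * d - 1) / c by rewrite -det opprB addrCA subrr addr0 mulfK.
    by field.
  by field.
rewrite !comp_preimage plane_measure_hshear ?plane_measure_vshear
  ?plane_measure_hshear//; rewrite -[X in measurable X]setTI.
  exact: measurable_hshear.
apply: measurable_vshear => //; rewrite -[X in measurable X]setTI.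
exact: measurable_hshear.
Qed.

End PlaneMeasure.

(** * Moments of a triangle *)

Lemma sum_ord3 (V : nmodType) (f : 'I_3 -> V) : \sum_i f i = f 0 + f 1 + f 2.
Proof.
rewrite !big_ord_recl big_ord0 addr0 addrA.
by congr (f _ + f _ + f _); apply/val_inj.
Qed.

Lemma ord3_ind (P : 'I_3 -> Prop) : P 0 -> P 1 -> P 2 -> forall i, P i.
Proof.
move=> P0 P1 P2 [[|[|[|//]]] i3].
- by rewrite (_ : Ordinal i3 = 0)//; apply/val_inj.
- by rewrite (_ : Ordinal i3 = 1)//; apply/val_inj.
- by rewrite (_ : Ordinal i3 = 2)//; apply/val_inj.
Qed.

Lemma ord3D : (0 + 1 = 1 :> 'I_3) * (0 + 2 = 2 :> 'I_3) * (1 + 1 = 2 :> 'I_3) *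
  (1 + 2 = 0 :> 'I_3) * (2 + 1 = 0 :> 'I_3) * (2 + 2 = 1 :> 'I_3).
Proof. by do !split; apply/val_inj. Qed.

Section Triangle.
Variables (R : realType) (v : 'I_3 -> R * R).
Hypothesis nd : Defs.nondegenerate v.
Notation phi := (barycentric v).
Notation mR := (measurableTypeR R).
Notation leb := (@lebesgue_measure R).
Notation mu := (leb \x leb)%E.
Notation tri := (triangle v : set (mR * mR)).

Lemma orient_cycle (a b c : R * R) : orient b c a = orient a b c.
Proof. by rewrite /orient; ring. Qed.

Lemma barycentricE x :
  (phi 0 x = orient x (v 1) (v 2) / orient (v 0) (v 1) (v 2)) *
  (phi 1 x = orient x (v 2) (v 0) / orient (v 0) (v 1) (v 2)) *
  (phi 2 x = orient x (v 0) (v 1) / orient (v 0) (v 1) (v 2)).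
Proof.
by rewrite /barycentric !ord3D !(orient_cycle (v 0)) -(orient_cycle (v 2)).
Qed.

Lemma sum_barycentric x : \sum_i phi i x = 1.
Proof.
rewrite sum_ord3 !barycentricE -!mulrDl -[RHS](mulfV nd); congr (_ / _).
by rewrite /orient; ring.
Qed.

Lemma barycentric_decomp x :
  x = (\sum_i phi i x * (v i).1, \sum_i phi i x * (v i).2).
Proof.
move: nd; rewrite /Defs.nondegenerate !sum_ord3 !barycentricE /orient => d0.
by case: x => x y /=; congr pair; field.
Qed.

Lemma barycentric_comb (l : 'I_3 -> R) i : \sum_i l i = 1 ->
  phi i (\sum_i l i * (v i).1, \sum_i l i * (v i).2) = l i.
Proof.
move: nd; rewrite /Defs.nondegenerate !sum_ord3 => d0 l1.
have {l1} l0 : l 0 = 1 - l 1 - l 2 by rewrite -l1; ring.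
by elim/ord3_ind: i; rewrite barycentricE l0; move: d0;
  rewrite /orient/= => d0; field.
Qed.

(** Barycentric coordinates are the only weights of sum 1 representing a point, so the convex
    weights in [triangle] must be these. *)
Lemma triangleP x : triangle v x <-> forall i, 0 <= phi i x.
Proof.
split=> [[l [l0 l1 ->]] i|p0]; first by rewrite barycentric_comb.
exists (phi^~ x); split=> //; [exact: sum_barycentric|exact: barycentric_decomp].
Qed.

Lemma barycentric_le1 x i : triangle v x -> phi i x <= 1.
Proof.
move=> /triangleP p0; rewrite -(sum_barycentric x) (bigD1 i)//= lerDl.
by apply: sumr_ge0 => j _; exact: p0.
Qed.

(** The affine map sending each [v j] to [v (j + 1)]. It makes the integrals of the three
    coordinates equal. *)
Definition vertex_cycle (x : R * R) : R * R :=
  (\sum_i phi (i + 2) x * (v i).1, \sum_i phi (i + 2) x * (v i).2).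

Lemma barycentric_vertex_cycle x i : phi i (vertex_cycle x) = phi (i + 2) x.
Proof.
apply: (barycentric_comb (l := fun i => phi (i + 2) x)).
by rewrite -(sum_barycentric x) !sum_ord3 !ord3D; ring.
Qed.

Lemma preimage_vertex_cycle : vertex_cycle @^-1` triangle v = triangle v.
Proof.
apply/seteqP; split=> x /=; rewrite !triangleP => p0 i.
  by have := p0 (i + 1); rewrite barycentric_vertex_cycle -addrA ord3D addr0.
by rewrite barycentric_vertex_cycle.
Qed.

Lemma measurable_barycentric i : measurable_fun [set: mR * mR] (phi i).
Proof.
have [a [b [c E]]] := barycentric_affine v i.
rewrite (_ : phi i = fun x => a + b * x.1 + c * x.2); last exact/funext.
have m1 := @measurable_fst _ _ mR mR; have m2 := @measurable_snd _ _ mR mR.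
apply: measurable_funD; last exact: measurable_funM.
by apply: measurable_funD; last exact: measurable_funM.
Qed.

Lemma measurable_triangle : measurable (triangle v : set (mR * mR)).
Proof.
rewrite (_ : triangle v = \bigcap_(i in [set: 'I_3]) (phi i @^-1` `[0, +oo[)).
  apply: fin_bigcap_measurable => // i _; rewrite -[X in measurable X]setTI.
  exact: measurable_barycentric.
apply/seteqP; split=> x; rewrite triangleP /bigcap /= => p0 i.
  by rewrite in_itv /= p0.
by have := p0 i I; rewrite in_itv /= andbT.
Qed.

Lemma measurable_vertex_cycle :
  measurable_fun [set: mR * mR] (vertex_cycle : mR * mR -> mR * mR).
Proof.
by apply: measurable_fun_pair; apply: measurable_sum => i;
  apply: measurable_funM => //; exact: measurable_barycentric.
Qed.

(* The cycle has order 3, hence no real eigenvector: this is why the lower left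
   entry of its linear part cannot vanish. *)
Lemma plane_measure_vertex_cycle (A : set (mR * mR)) : measurable A ->
  mu (vertex_cycle @^-1` A) = mu A.
Proof.
move=> mA; pose u := ((v 1).1 - (v 0).1, (v 1).2 - (v 0).2).
pose w := ((v 2).1 - (v 0).1, (v 2).2 - (v 0).2).
pose d := u.1 * w.2 - u.2 * w.1.
have d0 : d != 0 by move: nd; rewrite /Defs.nondegenerate/orient.
(* The numerator is the positive definite form [u.2 ^+ 2 - u.2 * w.2 + w.2 ^+ 2]. Its vanishing
   would give [u.2 = w.2 = 0], hence [d = 0]. *)
have c0 : ((w.2 - u.2) * w.2 + u.2 ^+ 2) / d != 0.
  rewrite mulf_neq0 ?invr_neq0//; apply: contra_neq d0 => E.
  have /eqP : (u.2 - w.2 / 2) ^+ 2 + (w.2 * w.2 * 3) / 4 = 0.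
    by rewrite -[RHS]E; field.
  have w20 : 0 <= (w.2 * w.2 * 3) / 4.
    by rewrite divr_ge0// mulr_ge0// -expr2 sqr_ge0.
  rewrite paddr_eq0 ?sqr_ge0// => /andP[].
  rewrite sqrf_eq0 !mulf_eq0 invr_eq0 !pnatr_eq0 !orbF orbb => /eqP u0 /eqP w0.
  by rewrite /d w0; move: u0; rewrite w0 mul0r subr0 => ->; ring.
(* These coefficients express, in the standard basis, the linear map with [u] to [w - u] and [w] to
   [- u]; the translation is the image of the origin. *)
rewrite -[RHS](@plane_measure_affine R (((w.1 - u.1) * w.2 + u.1 * u.2) / d)
  (- ((w.1 - u.1) * w.1 + u.1 * u.1) / d) _
  (- ((w.2 - u.2) * w.1 + u.2 * u.1) / d)
  (vertex_cycle (0, 0)).1 (vertex_cycle (0, 0)).2 A c0)//.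
  congr (mu _); apply/(congr1 (preimage^~ A))/funext => -[x y].
  rewrite /vertex_cycle/= !sum_ord3 !ord3D.
  rewrite !barycentricE; move: d0; rewrite /d /u /w /orient /= => d0.
  by congr pair; field.
by rewrite /d; field.
Qed.

Lemma triangle_bounded :
  exists M, forall x, triangle v x -> `|x.1| <= M /\ `|x.2| <= M.
Proof.
exists (\sum_i `|(v i).1| + \sum_i `|(v i).2|) => x tx.
have p1 i := barycentric_le1 i tx.
have /triangleP p0 := tx.
rewrite (barycentric_decomp x) /=; split.
  rewrite (le_trans (ler_norm_sum _ _ _))// -[leLHS]addr0 lerD ?sumr_ge0//.
  by apply: ler_sum => i _; rewrite normrM ger0_norm// ler_piMl.
rewrite (le_trans (ler_norm_sum _ _ _))// -[leLHS]add0r lerD ?sumr_ge0//.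
by apply: ler_sum => i _; rewrite normrM ger0_norm// ler_piMl.
Qed.

Lemma plane_measure_rect (a b c d : R) :
  mu (`[a, b] `*` `[c, d])%classic =
  ((if (a < b)%R then (b - a)%R%:E else 0) *
   (if (c < d)%R then (d - c)%R%:E else 0))%E.
Proof.
rewrite product_measure1E//= ?lebesgue_measure_itv/= ?lte_fin ?EFinB//.
Qed.

(** Needed because [area] is a [fine], which would be 0 at infinite measure. *)
Lemma plane_measure_triangle_lty : (mu tri < +oo)%E.
Proof.
have [M bM] := triangle_bounded.
apply: (@le_lt_trans _ _ (mu (`[- M, M] `*` `[- M, M])%classic)).
  apply: le_measure; rewrite ?inE//; first exact: measurable_triangle.
    exact: measurableX.
  move=> x tx /=; have [] := bM x tx; rewrite !ler_norml => /andP[a b] /andP[c d].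
  by rewrite !in_itv /= a b c d.
by rewrite plane_measure_rect; case: ifP => _; rewrite ?mul0e -?EFinM ?ltry ?mule0.
Qed.

(** Each coordinate equals 1/3 at the centroid and is affine. This places a small square inside the
    triangle, whence its positive area. *)
Lemma barycentric_ge0_near_centroid i : exists2 r : R, 0 < r &
  forall x, `|x.1 - \sum_j 3^-1 * (v j).1| <= r ->
            `|x.2 - \sum_j 3^-1 * (v j).2| <= r -> 0 <= phi i x.
Proof.
have [a [b [c E]]] := barycentric_affine v i.
have g : phi i (\sum_j 3^-1 * (v j).1, \sum_j 3^-1 * (v j).2) = 3^-1.
  by rewrite barycentric_comb// sum_ord3; lra.
(* On a square of half-side [(3 * K)^-1] the coordinate drops by at most
   [(|b| + |c|) / (3 * K) < 1/3]; the added 1 keeps [K] positive for a constant coordinate. *)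
pose K : R := `|b| + `|c| + 1.
have K0 : 0 < K by rewrite ltr_wpDl ?addr_ge0.
exists (3 * K)^-1 => [|x]; first by rewrite invr_gt0 mulr_gt0.
rewrite E in g => x1 x2; rewrite E.
set g1 := \sum_j _ in g x1 *; set g2 := \sum_j _ in g x2 *.
have -> : a + b * x.1 + c * x.2 = 3^-1 + b * (x.1 - g1) + c * (x.2 - g2).
  by rewrite -[in RHS]g /=; ring.
have h1 : - (b * (x.1 - g1)) <= `|b| * (3 * K)^-1.
  by rewrite (le_trans (ler_norm _))// normrN normrM ler_wpM2l.
have h2 : - (c * (x.2 - g2)) <= `|c| * (3 * K)^-1.
  by rewrite (le_trans (ler_norm _))// normrN normrM ler_wpM2l.
have h3 : 3^-1 = `|b| * (3 * K)^-1 + `|c| * (3 * K)^-1 + (3 * K)^-1.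
  by rewrite -mulrDl -[X in _ + X]mul1r -mulrDl -/K; field; rewrite gt_eqF.
have h4 : 0 < (3 * K)^-1 by rewrite invr_gt0 mulr_gt0.
lra.
Qed.

Lemma plane_measure_triangle_gt0 : (0 < mu tri)%E.
Proof.
have [r0 r00 H0] := barycentric_ge0_near_centroid 0.
have [r1 r10 H1] := barycentric_ge0_near_centroid 1.
have [r2 r20 H2] := barycentric_ge0_near_centroid 2.
pose r := Num.min r0 (Num.min r1 r2).
have r_gt0 : 0 < r by rewrite !lt_min r00 r10 r20.
set g1 := \sum_j _ in H0 H1 H2; set g2 := \sum_j _ in H0 H1 H2.
apply: (@lt_le_trans _ _
    (mu (`[g1 - r, g1 + r] `*` `[g2 - r, g2 + r])%classic)).
  have lt g : g - r < g + r by lra.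
  by rewrite plane_measure_rect !lt// -EFinM lte_fin mulr_gt0// subr_gt0.
apply: le_measure; rewrite ?inE//; first exact: measurableX.
  exact: measurable_triangle.
move=> x; rewrite /= !in_itv/= -!ler_distl !le_min => -[].
move=> /and3P[a0 a1 a2] /and3P[b0 b1 b2].
by apply/triangleP; elim/ord3_ind; [apply: H0|apply: H1|apply: H2].
Qed.

Lemma area_gt0 : 0 < area (triangle v).
Proof.
by rewrite fine_gt0// plane_measure_triangle_gt0 plane_measure_triangle_lty.
Qed.

(** Change of variables along [vertex_cycle], which preserves both the measure and the triangle and
    shifts the index by 2. *)
Lemma integral_barycentric_shift i :
  (\int[mu]_(x in tri) (phi i x)%:E = \int[mu]_(x in tri) (phi (i + 2) x)%:E)%E.
Proof.
have mcycle := measurable_vertex_cycle.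
have mt := measurable_triangle.
transitivity (\int[pushforward mu (vertex_cycle : mR * mR -> mR * mR)]_(x in tri)
  (phi i x)%:E)%E.
  apply: eq_measure_integral => A mA _.
  exact: (esym (plane_measure_vertex_cycle mA)).
rewrite ge0_integral_pushforward//.
- rewrite preimage_vertex_cycle; apply: eq_integral => x _.
  by rewrite /= barycentric_vertex_cycle.
- apply/measurable_EFinP; apply: measurable_funTS; exact: measurable_barycentric.
- by move=> x; rewrite inE lee_fin => /triangleP.
Qed.

(** The three integrals coincide, and they add up to the area since the coordinates sum to 1. *)
Lemma Rintegral_barycentric i :
  \int[@plane_measure R]_(x in triangle v) phi i x = area (triangle v) / 3.
Proof.
have mt := measurable_triangle.
have mp j : measurable_fun tri (fun x => (phi j x)%:E).
  by apply/measurable_EFinP/measurable_funTS; exact: measurable_barycentric.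
have p0 j x : tri x -> (0 <= (phi j x)%:E)%E by rewrite lee_fin => /triangleP.
have e20 := integral_barycentric_shift 0; have e12 := integral_barycentric_shift 2.
rewrite ord3D in e20; rewrite ord3D in e12.
set I0 := (\int[mu]_(x in tri) (phi 0 x)%:E)%E in e20.
have eI j : (\int[mu]_(x in tri) (phi j x)%:E = I0)%E.
  by elim/ord3_ind: j => //; rewrite -?e12 -e20.
have : mu tri = (I0 + I0 + I0)%E.
  transitivity (\sum_(i < 3) \int[mu]_(x in tri) (phi i x)%:E)%E.
    rewrite -ge0_integral_sum// -[LHS]mul1e -integral_cst//.
    by apply: eq_integral => x _; rewrite sumEFin sum_barycentric.
  by rewrite sum_ord3 !eI.
rewrite /area /Rintegral -/mu eI => E.
have := plane_measure_triangle_lty; rewrite /plane_measure E.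
have : (0 <= I0)%E by apply: integral_ge0 => x; exact: p0.
(* Infinite values are excluded by nonnegativity and the finite area. *)
case: I0 {E eI e20 e12} => //= r _ _.
by field.
Qed.

End Triangle.

(** * Bilinear hat functions *)

Section Bilinear.
Variables (R : realType) (Omega : set (R * R)) (G : grid R).
Hypothesis GA : admissible_grid Omega G.
Notation h := (step G).
Implicit Types j k : 'I_(nint G + nout G).

(** Clipping at 0 replaces the case distinction on cells in [bilinear], so that Lipschitz bounds
    hold across cell boundaries. *)
Definition tent (s : R) : R := Num.max 0 (1 - `|s| / h).

Lemma tent_ge0 s : 0 <= tent s.
Proof. by rewrite /tent le_max lexx. Qed.

Lemma tent_le1 s : tent s <= 1.
Proof.
by rewrite /tent ge_max ler01 gerBl divr_ge0// ltW// (step_gt0 GA).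
Qed.

Lemma tent_lipschitz s t : `|tent s - tent t| <= `|s - t| / h.
Proof.
have h0 := step_gt0 GA.
wlog st : s t / `|s| <= `|t|.
  by move=> H; have [/H//|/ltW/H] := leP `|s| `|t|; rewrite distrC (distrC t).
have le : (`|t| - `|s|) / h <= `|s - t| / h.
  by rewrite ler_pM2r ?invr_gt0// distrC lerB_dist.
have m : `|s| / h <= `|t| / h by rewrite ler_pM2r ?invr_gt0.
have d0 : 0 <= `|s - t| / h by rewrite divr_ge0// ltW.
rewrite mulrBl in le; rewrite /tent ler_norml.
by case: (leP 0 (1 - `|s| / h)) => a; case: (leP 0 (1 - `|t| / h)) => b; lra.
Qed.

(** A coordinate less than one step away from grid line [i] lies in an interval ending at [i]: the
    one on its right or the one on its left. *)
Lemma interval_cell (n i : nat) (s : R) : (0 < n)%N -> (i <= n)%N ->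
  0 <= s <= n%:R * h -> `|s - i%:R * h| < h ->
  exists2 l : nat, (l < n)%N & l%:R * h <= s <= l.+1%:R * h /\
    exists b : bool, i = (l + b)%N.
Proof.
have h0 := step_gt0 GA.
move=> n0 ik /andP[s0 sn]; rewrite ltr_norml => /andP[l u].
have [si|si] := leP (i%:R * h) s.
  have [ni|ni] := ltnP i n.
    exists i => //; split; last by exists false; rewrite addn0.
    by rewrite si -natr1 mulrDl mul1r ltW//; lra.
  (* At the right end of the grid [s] is [n%:R * h], and the interval to take is the last one,
     [n.-1]. *)
  have /eqP E : i == n by rewrite eqn_leq ik ni.
  exists n.-1; first by rewrite prednK.
  rewrite prednK// sn andbT; split; last by exists true; rewrite addn1 prednK.
  by rewrite (le_trans _ si)// ler_pM2r// ler_nat E leq_pred.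
have i0 : (0 < i)%N.
  by case: (i) si => //; rewrite mul0r => /(le_lt_trans s0); rewrite ltxx.
exists i.-1; first by rewrite prednK.
rewrite prednK// (ltW si) andbT; split; last by exists true; rewrite addn1 prednK.
have : i%:R = i.-1%:R + 1 :> R by rewrite natr1 prednK.
by move=> E; move: l; rewrite E mulrDl mul1r; lra.
Qed.

Lemma node_grid_point j :
  exists i k : nat, [/\ (i <= ncell1 G)%N, (k <= ncell2 G)%N &
  node j = grid_point G i k].
Proof.
have : range (@node R G) (node j) by exists j.
rewrite (node_range GA) => -[[i k] /= [ii kk] <-].
by exists i, k.
Qed.

Lemma rectangle_node j : rectangle G (node j).
Proof.
have h0 := step_gt0 GA.
have [i [k [ii kk ->]]] := node_grid_point j.
by rewrite /rectangle /box /grid_point/= !lerD2l !ler_pM2r// !ler_nat !leq0n ii kk.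
Qed.

(** In a cell having the node as a vertex neither tent is clipped. If no such cell contains [x],
    some coordinate is at least one step away, since otherwise [interval_cell] in both directions
    would produce one. *)
Lemma bilinearE j x : rectangle G x ->
  Defs.bilinear j x = tent (x.1 - (node j).1) * tent (x.2 - (node j).2).
Proof.
have h0 := step_gt0 GA.
move=> [/=]; rewrite !mul0r !addr0 => /andP[l1 u1] /andP[l2 u2].
rewrite /Defs.bilinear; case: asboolP => [[i [k [ii kk [/= c1 c2] [[p1 p2] _ E]]]]|nc].
  have le1 (m : nat) (b : bool) o y : o + m%:R * h <= y <= o + m.+1%:R * h ->
      0 <= 1 - `|y - (o + (m + b)%:R * h)| / h.
    rewrite -natr1 natrD subr_ge0 ler_pdivrMr// mul1r ler_norml.
    by case: b; rewrite !mulrDl ?mul1r ?mul0r; lra.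
  rewrite /tent !max_r// -E /grid_point/=; exact: le1.
have [i [k [ii kk E]]] := node_grid_point j.
have [t1|t1] := leP h `|x.1 - (node j).1|.
  rewrite {1}/tent max_l ?mul0r// subr_le0 ler_pdivlMr// mul1r//.
have [t2|t2] := leP h `|x.2 - (node j).2|.
  rewrite {2}/tent (max_l _) ?mulr0// subr_le0 ler_pdivlMr// mul1r//.
case: nc; rewrite E /= !opprD !addrA in t1 t2.
have [] := interval_cell (ncell1_gt0 GA) ii _ t1; first by rewrite subr_ge0 l1 lerBlDl.
move=> i' i'n [/andP[a1 b1] [p1 p1E]].
have [] := interval_cell (ncell2_gt0 GA) kk _ t2; first by rewrite subr_ge0 l2 lerBlDl.
move=> k' k'n [/andP[a2 b2] [p2 p2E]].
exists i', k'; split => //.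
  by split; apply/andP; split => /=; lra.
by exists (p1, p2) => //=; rewrite -p1E -p2E E.
Qed.

Lemma bilinear_lipschitz j x y d : rectangle G x -> rectangle G y ->
  `|x.1 - y.1| <= d -> `|x.2 - y.2| <= d ->
  `|Defs.bilinear j x - Defs.bilinear j y| <= 2 * d / h.
Proof.
have h0 := step_gt0 GA.
move=> rx ry d1 d2; rewrite !bilinearE//.
set a := tent (x.1 - _); set b := tent (x.2 - _).
set a' := tent (y.1 - _); set b' := tent (y.2 - _).
have -> : a * b - a' * b' = (a - a') * b + a' * (b - b') by ring.
have A : `|a - a'| <= d / h.
  rewrite (le_trans (tent_lipschitz _ _))// ler_pM2r ?invr_gt0//.
  by rewrite opprD addrACA subrr addr0.
have B : `|b - b'| <= d / h.
  rewrite (le_trans (tent_lipschitz _ _))// ler_pM2r ?invr_gt0//.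
  by rewrite opprD addrACA subrr addr0.
have -> : 2 * d / h = d / h + d / h by ring.
rewrite (le_trans (ler_normD _ _))// lerD// normrM.
  by rewrite (ger0_norm (tent_ge0 _)) (le_trans _ A)// ler_piMr// tent_le1.
by rewrite (ger0_norm (tent_ge0 _)) (le_trans _ B)// ler_piMl// tent_le1.
Qed.

(** Turns an entry of the identity into a value of a hat function, so that an entry of [Z] becomes a
    projection error at a node. *)
Lemma bilinear_node j k : Defs.bilinear k (node j) = (j == k)%:R.
Proof.
have h0 := step_gt0 GA.
rewrite bilinearE; last exact: rectangle_node.
have tent0 : tent 0 = 1 by rewrite /tent normr0 mul0r subr0 max_r ?ler01.
case: eqVneq => [->|jk]; first by rewrite !subrr tent0 mulr1.
have tentN (o : R) (m n : nat) : m != n ->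
    tent (o + m%:R * h - (o + n%:R * h)) = 0.
  move=> mn; rewrite /tent max_l// subr_le0 ler_pdivlMr// mul1r.
  rewrite (_ : _ - _ = (m%:R - n%:R) * h); last by ring.
  rewrite normrM (gtr0_norm h0) ler_peMl//; first exact: ltW.
  by case: (ltngtP m n) mn => // lt _; [rewrite distrC|];
    apply: le_trans (ler_norm _); rewrite lerBrDr addrC natr1 ler_nat.
have [i [l [_ _ E]]] := node_grid_point j.
have [i' [l' [_ _ E']]] := node_grid_point k.
rewrite E E' /grid_point/=.
have [ii|?] := eqVneq i i'; last by rewrite tentN// mul0r.
have [ll|?] := eqVneq l l'; last by rewrite mulrC tentN// mul0r.
by case/eqP: jk; apply: (node_inj GA); rewrite E E' ii ll.
Qed.

End Bilinear.

(** * Infinity norm and invertibility *)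

Section InfNorm.
Variable R : realType.
Notation normc := (@ComplexField.Normc.normc R).

Lemma normc_ge0 (z : R[i]) : 0 <= normc z.
Proof. by case: z => a b; exact: sqrtr_ge0. Qed.

Lemma normc_real (x : R) : normc (real_complex R x) = `|x|.
Proof. by rewrite /= expr0n addr0 sqrtr_sqr. Qed.

Lemma normc_sum (I : finType) (f : I -> R[i]) :
  normc (\sum_i f i) <= \sum_i normc (f i).
Proof.
elim/big_ind2 : _ => // [|x a y b xa yb].
  by rewrite ComplexField.Normc.normc0.
by rewrite (le_trans (le_normcD _ _))// lerD.
Qed.

Lemma infnorm_ge0 m n (X : 'M[R[i]]_(m, n)) : 0 <= infnorm X.
Proof. exact: bigmax_ge_id. Qed.

Lemma row_le_infnorm m n (X : 'M[R[i]]_(m, n)) i :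
  \sum_j normc (X i j) <= infnorm X.
Proof. exact: (le_bigmax 0 (fun i => \sum_j normc (X i j))). Qed.

Lemma infnorm_le m n (X : 'M[R[i]]_(m, n)) b : 0 <= b ->
  (forall i, \sum_j normc (X i j) <= b) -> infnorm X <= b.
Proof. by move=> b0 Xb; apply: bigmax_le. Qed.

(** A kernel vector satisfies [u = X u]; at an entry of maximal modulus this gives
    [|u_k| <= infnorm X * |u_k|], which is absurd. Transposition converts the left kernel of [det0P]
    into a right one. *)
Lemma unitmx_1B_infnorm n (X : 'M[R[i]]_n) : infnorm X < 1 ->
  1%:M - X \in unitmx.
Proof.
move=> X1; rewrite -unitmx_tr unitmxE unitfE; apply/negP => /det0P[u u0 E].
move: E; rewrite linearB/= trmx1 mulmxBr mulmx1 => /subr0_eq E.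
have [j uj] : exists j, u 0 j != 0 by apply/rV0Pn.
pose k := [arg max_(k > j) normc (u 0 k)]%O.
have kmax l : normc (u 0 l) <= normc (u 0 k).
  by rewrite /k; case: Order.TotalTheory.arg_maxP => // k' _; apply.
have uk : 0 < normc (u 0 k).
  rewrite (lt_le_trans _ (kmax j))// lt_def normc_ge0 andbT.
  by apply: contra_neq uj => /ComplexField.Normc.eq0_normc.
have : normc (u 0 k) <= infnorm X * normc (u 0 k).
  rewrite {1}E mxE (le_trans (normc_sum _))//.
  rewrite (le_trans _ (ler_wpM2r (ltW uk) (row_le_infnorm X k)))// mulr_suml.
  apply: ler_sum => l _; rewrite mxE ComplexField.Normc.normcM mulrC.
  by rewrite ler_wpM2l ?normc_ge0.
by rewrite ler_pMl// leNgt X1.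
Qed.

(** The lower rows of [Z] only meet zero columns of [Y]; this is how the bound gets by with the
    interior rows. *)
Lemma infnorm_mul_lcols m n p q (Y : 'M[R[i]]_(q, m + n)) (Z : 'M[R[i]]_(m + n, p)) :
  (forall i k, Y i (rshift m k) = 0) ->
  infnorm (Y *m Z) <= infnorm Y * infnorm (usubmx Z).
Proof.
move=> Y0; apply: infnorm_le => [|i]; first by rewrite mulr_ge0 ?infnorm_ge0.
rewrite (le_trans _ (ler_wpM2r (infnorm_ge0 _) (row_le_infnorm Y i)))//.
rewrite big_split_ord/= [X in _ + X]big1 => [|k _]; last first.
  by rewrite Y0 ComplexField.Normc.normc0.
rewrite addr0 mulr_suml; under eq_bigr => j _.
  rewrite mxE big_split_ord/= [X in _ + X]big1 => [|k _]; last first.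
    by rewrite Y0 mul0r.
  rewrite addr0; over.
apply: (@le_trans _ _ (\sum_j \sum_l normc (Y i (lshift n l) * Z (lshift n l) j))).
  by apply: ler_sum => j _; exact: normc_sum.
rewrite exchange_big; apply: ler_sum => l _ /=.
under eq_bigr do rewrite ComplexField.Normc.normcM.
rewrite -mulr_sumr ler_wpM2l ?normc_ge0// (le_trans _ (row_le_infnorm _ l))//.
by apply: ler_sum => j _; rewrite mxE.
Qed.

End InfNorm.

(** The inverse is explicit: [1 - D (1 + C D)^-1 C]. *)
Lemma unitmx_1D_mulC (F : fieldType) m n (C : 'M[F]_(m, n)) (D : 'M[F]_(n, m)) :
  1%:M + C *m D \in unitmx -> 1%:M + D *m C \in unitmx.
Proof.
move=> u.
have DE : (1%:M + D *m C) *m D = D *m (1%:M + C *m D).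
  by rewrite mulmxDl mul1mx mulmxDr mulmx1 mulmxA.
have : (1%:M + D *m C) *m (1%:M - D *m invmx (1%:M + C *m D) *m C) = 1%:M.
  by rewrite mulmxBr mulmx1 !mulmxA DE -(mulmxA D) mulmxV// mulmx1 addrK.
by case/mulmx1_unit.
Qed.

(** * Local projection *)

Section LocalProjection.
Variables (R : realType) (Omega : set (R * R)) (T : mesh R) (Y : quadrature R).
Hypothesis TA : triangulation Omega T.
Hypothesis YA : admissible_quadrature Omega T Y.
Notation y_ := (@qnode R Y).
Notation w_ := (@qweight R Y).
Implicit Types t : 'I_(nelt T).

Lemma hatE (v : 'I_3 -> R * R) i x : triangle v x -> hat v i x = barycentric v i x.
Proof. by move=> vx; rewrite /hat patchT// inE. Qed.

Lemma hat_notin (v : 'I_3 -> R * R) i x : ~ triangle v x -> hat v i x = 0.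
Proof. by move=> vx; rewrite /hat patchN// notin_setE. Qed.

Lemma hat_ge0 (v : 'I_3 -> R * R) i x : Defs.nondegenerate v -> 0 <= hat v i x.
Proof.
move=> nd; have [vx|vx] := pselect (triangle v x); last by rewrite hat_notin.
by rewrite hatE//; move/(triangleP nd): vx.
Qed.

(** The hat vanishes off its triangle, so the global sum is the local rule, exact on the affine
    coordinate. *)
Lemma quadrature_hat t i :
  \sum_q w_ q * hat (elt t) i (y_ q) = area (triangle (elt t)) / 3.
Proof.
have nd := elt_nondegenerate TA t.
rewrite -(Rintegral_barycentric nd i).
have [a [b [c E]]] := barycentric_affine (elt t) i.
rewrite (_ : barycentric _ i = fun x => a + b * x.1 + c * x.2); last exact/funext.
rewrite (exact_degree1 YA) /qsum [RHS]big_mkcond; apply: eq_bigr => q _.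
case: asboolP => yt; last by rewrite hat_notin ?mulr0.
by rewrite hatE// E.
Qed.

(** The mass matrix is [|tau| / 12] times [1 + J], with [J] the all-ones matrix of order 3, and
    [(1 + J)^-1 = 1 - J / 4]. *)
Definition mass_inv (v : 'I_3 -> R * R) : 'M[R]_3 :=
  \matrix_(i, j) if i == j then 9 / area (triangle v) else - 3 / area (triangle v).

Lemma mul_mass_inv v : Defs.nondegenerate v -> mass v *m mass_inv v = 1%:M.
Proof.
move=> nd; have a0 : area (triangle v) != 0 by rewrite gt_eqF// area_gt0.
by apply/matrixP => i j; rewrite mxE sum_ord3 !mxE; elim/ord3_ind: i;
  elim/ord3_ind: j; rewrite /=; field.
Qed.

Lemma invmx_Mtri : invmx (Mtri T) = \mxdiag_(t < nelt T) mass_inv (elt t).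
Proof.
have E : Mtri T *m (\mxdiag_(t < nelt T) mass_inv (elt t)) = 1%:M.
  rewrite /Mtri -[RHS]mxdiagZ {1}/mxdiag mul_mxblock_mxdiag; apply/eq_mxblock => s t.
  case: eqVneq => [|st]; last by rewrite mul0mx.
  by case: _ / => /=; rewrite !conform_mx_id mul_mass_inv//; exact: (elt_nondegenerate TA).
by rewrite -[RHS]mul1mx -(mulVmx (mulmx1_unit E).1) -mulmxA E mulmx1.
Qed.

Definition projection_kernel (v : 'I_3 -> R * R) (z y : R * R) : R :=
  \sum_i \sum_j hat v i z * mass_inv v i j * hat v j y.

Lemma TQC_interior (G : grid R) (ch : 'I_(nint G) -> 'I_(nelt T)) j q :
  TQC ch Y (lshift (nout G) j) q =
  projection_kernel (elt (ch j)) (node (lshift (nout G) j)) (y_ q) * w_ q.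
Proof.
rewrite /TQC col_mxEu /Wmx mul_mx_diag mxE [X in _ * X]mxE; congr (_ * _).
rewrite invmx_Mtri /EC mul_mxrow_mxdiag /EQ tr_mxrow mul_mxrow_mxcol summxE.
rewrite (bigD1 (ch j))//= [X in _ + X]big1 ?addr0 => [|t /negPf tch]; last first.
  rewrite mxE big1// => k _; rewrite !mxE big1 ?mul0r// => i _.
  by rewrite !mxE tch mul0r.
rewrite mxE /projection_kernel exchange_big; apply: eq_bigr => k _ /=.
rewrite !mxE mulr_suml; apply: eq_bigr => i _; rewrite !mxE eqxx//.
Qed.

(** Rows of [mass_inv] sum to [(9 - 3 - 3) / |tau|], which cancels the moment [|tau| / 3]; what
    remains is the sum of the coordinates of [z]. *)
Lemma projection_kernel_sum t z : triangle (elt t) z ->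
  \sum_q projection_kernel (elt t) z (y_ q) * w_ q = 1.
Proof.
move=> tz; have nd := elt_nondegenerate TA t.
have a0 : area (triangle (elt t)) != 0 by rewrite gt_eqF// area_gt0.
transitivity (\sum_i \sum_j hat (elt t) i z * mass_inv (elt t) i j *
    (area (triangle (elt t)) / 3)).
  under eq_bigr do rewrite mulr_suml; rewrite exchange_big; apply: eq_bigr => i _ /=.
  under eq_bigr do rewrite mulr_suml; rewrite exchange_big; apply: eq_bigr => j _ /=.
  rewrite -(quadrature_hat _ j) mulr_sumr; apply: eq_bigr => q _; ring.
rewrite -[RHS](sum_barycentric nd z); apply: eq_bigr => i _; rewrite hatE//.
by rewrite sum_ord3 !mxE; elim/ord3_ind: i => /=; field.
Qed.

(** With nonnegative hats and weights, absolute values fall on [mass_inv] alone: its absolute row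
    sum [15 / |tau|] times [|tau| / 3] is 5. *)
Lemma projection_kernel_norm_sum t z : triangle (elt t) z ->
  \sum_q `|projection_kernel (elt t) z (y_ q)| * w_ q <= 5.
Proof.
move=> tz; have nd := elt_nondegenerate TA t.
have a0 := area_gt0 nd.
apply: (@le_trans _ _ (\sum_q (\sum_i \sum_j hat (elt t) i z *
    `|mass_inv (elt t) i j| * hat (elt t) j (y_ q)) * w_ q)).
  apply: ler_sum => q _; rewrite ler_wpM2r ?(ltW (qweight_gt0 YA q))//.
  rewrite (le_trans (ler_norm_sum _ _ _))//; apply: ler_sum => i _.
  rewrite (le_trans (ler_norm_sum _ _ _))//; apply: ler_sum => j _.
  by rewrite !normrM (ger0_norm (hat_ge0 i z nd)) (ger0_norm (hat_ge0 j _ nd)).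
rewrite (_ : \sum_q _ = \sum_i \sum_j hat (elt t) i z * `|mass_inv (elt t) i j| *
    (area (triangle (elt t)) / 3)); last first.
  under eq_bigr do rewrite mulr_suml; rewrite exchange_big; apply: eq_bigr => i _ /=.
  under eq_bigr do rewrite mulr_suml; rewrite exchange_big; apply: eq_bigr => j _ /=.
  rewrite -(quadrature_hat _ j) mulr_sumr; apply: eq_bigr => q _; ring.
rewrite -[leRHS]mulr1 -[X in _ <= _ * X](sum_barycentric nd z) mulr_sumr.
rewrite le_eqVlt; apply/orP; left.
apply/eqP; apply: eq_bigr => i _; rewrite hatE// sum_ord3 !mxE.
have a1 : area (triangle (elt t)) != 0 by rewrite gt_eqF.
by elim/ord3_ind: i => /=; rewrite !normrM normrN !normr_nat normfV (gtr0_norm a0);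
  field.
Qed.

(** As the kernel weights sum to 1, the error is a weighted sum of differences [f z - f (y_ q)], and
    the kernel vanishes at nodes outside the element. *)
Lemma projection_kernel_error t z (f : R * R -> R) e :
  0 <= e -> triangle (elt t) z ->
  (forall q, triangle (elt t) (y_ q) -> `|f z - f (y_ q)| <= e) ->
  `|f z - \sum_q projection_kernel (elt t) z (y_ q) * w_ q * f (y_ q)| <= 5 * e.
Proof.
move=> e0 tz fe.

rewrite -{1}[f z]mul1r -[X in `|X * _ - _|](projection_kernel_sum tz)
  mulr_suml -sumrB.
rewrite (le_trans (ler_norm_sum _ _ _))//.
rewrite (le_trans _ (ler_wpM2r e0 (projection_kernel_norm_sum tz)))// mulr_suml.
apply: ler_sum => q _; rewrite -mulrBr !normrM (gtr0_norm (qweight_gt0 YA q)).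
have [yt|yt] := pselect (triangle (elt t) (y_ q)).
  by rewrite ler_wpM2l ?fe// mulr_ge0// ltW// (qweight_gt0 YA).
have -> : projection_kernel (elt t) z (y_ q) = 0.
  by rewrite /projection_kernel !big1// => i _; rewrite big1// => j _;
    rewrite (hat_notin _ yt) mulr0.
by rewrite normr0 !mul0r.
Qed.

End LocalProjection.

(** * Round trip *)

Section Diam.
Variables (R : realType) (v : 'I_3 -> R * R).
Hypothesis nd : Defs.nondegenerate v.

Lemma edist_le_diam x y : triangle v x -> triangle v y ->
  Defs.edist x y <= diam (triangle v).
Proof.
move=> tx ty; apply: ub_le_sup; last by exists (x, y).
(* A [sup] is an upper bound only for a bounded set, so the distances have to be bounded first. *)
have [M bM] := triangle_bounded nd.
exists (Num.sqrt ((2 * M) ^+ 2 + (2 * M) ^+ 2)) => _ [[a b] [/= ta tb] <-].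
have [a1 a2] := bM a ta; have [b1 b2] := bM b tb.
have sq s t : `|s| <= M -> `|t| <= M -> (s - t) ^+ 2 <= (2 * M) ^+ 2.
  move=> sM tM; rewrite -[leLHS]real_normK ?num_real// lerXn2r ?nnegrE//.
    by rewrite mulr_ge0// (le_trans _ sM).
  by rewrite (le_trans (ler_normB _ _))// mulr2n mulrDl !mul1r lerD.
by rewrite ler_wsqrtr// lerD// sq.
Qed.

Lemma coord_le_edist (x y : R * R) :
  `|x.1 - y.1| <= Defs.edist x y /\ `|x.2 - y.2| <= Defs.edist x y.
Proof.
by split; rewrite -sqrtr_sqr ler_wsqrtr// ?lerDl ?lerDr sqr_ge0.
Qed.

End Diam.

Lemma le_mesh_size (R : realType) (T : mesh R) (t : 'I_(nelt T)) :
  diam (triangle (elt t)) <= mesh_size T.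
Proof. exact: (le_bigmax 0 (fun t => diam (triangle (elt t)))). Qed.

Lemma round_trip_error (R : realType) (Omega : set (R * R)) (G : grid R)
    (T : mesh R) (Y : quadrature R) (ch : 'I_(nint G) -> 'I_(nelt T)) i l :
  admissible_grid Omega G -> triangulation Omega T ->
  admissible_quadrature Omega T Y ->
  (forall j, triangle (elt (ch j)) (node (lshift (nout G) j))) ->
  `|(1%:M - TQC ch Y *m TCQ G Y) (lshift (nout G) i) l| <=
    10 * mesh_size T / step G.
Proof.
move=> GA TA YA chP.
have h0 := step_gt0 GA.
have nd := elt_nondegenerate TA (ch i).
have d0 : 0 <= mesh_size T by exact: bigmax_ge_id.
have e0 : 0 <= 2 * mesh_size T / step G by rewrite divr_ge0 ?(ltW h0)// mulr_ge0.
have -> : 10 * mesh_size T / step G = 5 * (2 * mesh_size T / step G) by ring.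
rewrite !mxE -(bilinear_node GA (lshift (nout G) i) l).
under eq_bigr do rewrite (TQC_interior TA) mxE.
apply: (projection_kernel_error TA YA e0 (chP i)) => q yt.
have [d1 d2] := coord_le_edist (node (lshift (nout G) i)) (qnode q).
have le : Defs.edist (node (lshift (nout G) i)) (qnode q) <= mesh_size T.
  by rewrite (le_trans (edist_le_diam nd (chP i) yt))// le_mesh_size.
apply: (bilinear_lipschitz GA); rewrite ?(le_trans d1)// ?(le_trans d2)//.
  exact: (rectangle_node GA).
exact/(closure_sub_rectangle GA)/subset_closure/(qnode_in YA).
Qed.

Theorem theorem5p5 (R : realType) (Omega : set (R * R)) (G : grid R)
    (F : set (mesh R)) (S : 'M[R[i]]_(nint G + nout G)) :
  open Omega -> bounded_set Omega ->
  lipschitz_domain Omega -> polygonal Omega ->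
  admissible_grid Omega G ->
  (forall T, F T -> triangulation Omega T) ->
  shape_regular F -> quasi_uniform F ->
  S \in unitmx ->
  (forall (i : 'I_(nint G + nout G)) (k : 'I_(nout G)),
     (S - 1%:M) i (rshift (nint G) k) = 0) ->
  exists h0 : R, 0 < h0 /\
    forall T : mesh R, F T -> mesh_size T < h0 ->
    forall Y : quadrature R, admissible_quadrature Omega T Y ->
    forall ch : 'I_(nint G) -> 'I_(nelt T),
    (forall j, triangle (elt (ch j)) (node (lshift (nout G) j))) ->
    let A : 'M[R[i]]_(nquad Y, nint G + nout G) := toC (TCQ G Y) in
    let B : 'M[R[i]]_(nint G + nout G, nquad Y) := toC (TQC ch Y) in
    let RC := B *m A in
    let Z := 1%:M - RC in
    let Q := 1%:M + (S - 1%:M) *m RC in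
    let P := A *m S *m B + (1%:M - A *m B) in
    [/\ infnorm (invmx S *m (S - 1%:M)) * infnorm (usubmx Z) < 1,
        Q \in unitmx & P \in unitmx].
Proof.
move=> _ _ _ _ GA FT _ _ Su S0.
have h0 := step_gt0 GA.
set X := invmx S *m (S - 1%:M); set N := (nint G + nout G)%N.
(* A row of [Z_I] has [N] entries of size at most [10 h / h_C]; for [h < h_C / K] their sum is at
   most [(infnorm X + 1)^-1]. The added ones cover [N = 0] and [X = 0]. *)
pose K := 10 * (N%:R + 1) * (infnorm X + 1).
have X0 := infnorm_ge0 X.
have X1 : 0 < infnorm X + 1 by rewrite ltr_wpDl.
have N1 : 0 < N%:R + 1 :> R by rewrite ltr_wpDl.
have K0 : 0 < K by rewrite !mulr_gt0.
exists (step G / K); split; first by rewrite divr_gt0.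
move=> T TF hT Y YA ch chP A B RC Z Q P.
have TA := FT T TF.
have d0 : 0 <= mesh_size T by exact: bigmax_ge_id.
have ZI : infnorm (usubmx Z) <= (infnorm X + 1)^-1.
  apply: infnorm_le => [|i]; first by rewrite invr_ge0 ltW.
  have ZE : Z = toC (1%:M - TQC ch Y *m TCQ G Y).
    by rewrite /toC map_mxB map_mx1 map_mxM.
  apply: (@le_trans _ _ (\sum_(l < N) 10 * mesh_size T / step G)).
    apply: ler_sum => l _; rewrite mxE ZE mxE normc_real.
    exact: (round_trip_error i l GA TA YA chP).
  rewrite sumr_const card_ord -[leLHS]mulr_natl.
  have : 10 * mesh_size T / step G <= (N%:R + 1)^-1 * (infnorm X + 1)^-1.
    move: hT; rewrite ltr_pdivlMr// => /ltW hT.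
    rewrite ler_pdivrMr// -invfM ler_pdivlMl ?mulr_gt0//.
    by apply: le_trans hT; rewrite /K le_eqVlt; apply/orP; left; apply/eqP; ring.
  move=> le; rewrite (le_trans (ler_wpM2l _ le))// mulrA ler_piMl//.
    by rewrite invr_ge0 ltW.
  by rewrite ler_pdivrMr// mul1r lerDl.
have XZ : infnorm X * infnorm (usubmx Z) < 1.
  rewrite (le_lt_trans (ler_wpM2l X0 ZI))// ltr_pdivrMr// mul1r ltrDl//.
have X_rshift i k : X i (rshift (nint G) k) = 0.
  by rewrite mxE big1// => j _; rewrite S0 mulr0.
(* Since [S X = S - 1], the right side is [S - (S - 1) (1 - RC)]. *)
have QE : Q = S *m (1%:M - X *m Z).
  have SX : S *m X = S - 1%:M by rewrite /X mulmxA mulmxV// mul1mx.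
  rewrite mulmxBr mulmx1 mulmxA SX /Z mulmxBr mulmx1 opprB /Q.
  by rewrite opprB [RHS]addrCA [X in _ = _ + X]addrC subrK addrC.
have Qu : Q \in unitmx.
  rewrite QE unitmx_mul Su unitmx_1B_infnorm//.
  by rewrite (le_lt_trans (infnorm_mul_lcols Z X_rshift)).
split=> //.
(* With [C = (S - 1) B] this reads [P = 1 + A C], while [Q = 1 + C A]. *)
have -> : P = 1%:M + A *m ((S - 1%:M) *m B).
  by rewrite /P mulmxBl mul1mx mulmxBr mulmxA addrCA.
by apply: unitmx_1D_mulC; rewrite -mulmxA.
Qed.
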